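(* Let $\mathscr{A}=(a_{ijklpq})\in\mathbb{T}_{6,3}$ be a paired symmetric tensor, and let $N^1,\ldots,N^6\in\mathbb{R}^{27\times27}$ be the matrices defined, for all $i,j,k,l,p,q\in\{1,2,3\}$, by $$N^1_{9(i-1)+3(k-1)+p,\;9(j-1)+3(l-1)+q}=a_{ijklpq},\qquad N^2_{9(k-1)+3(i-1)+p,\;9(l-1)+3(j-1)+q}=a_{ijklpq},$$ $$N^3_{9(p-1)+3(k-1)+i,\;9(q-1)+3(l-1)+j}=a_{ijklpq},\qquad N^4_{9(i-1)+3(p-1)+k,\;9(j-1)+3(q-1)+l}=a_{ijklpq},$$ $$N^5_{9(k-1)+3(p-1)+i,\;9(l-1)+3(q-1)+j}=a_{ijklpq},\qquad N^6_{9(p-1)+3(i-1)+k,\;9(q-1)+3(j-1)+l}=a_{ijklpq}.$$ Then: (i) the polynomial $\mathscr{A}x^2y^2z^2$ is a sum of squares of trilinear forms if one of the matrices $N^1,\ldots,N^6$ is positive semidefinite; furthermore, if $\mathscr{A}$ is an elasticity tensor, then these six conditions are the same. (ii) The polynomial $\mathscr{A}x^2y^2z^2$ is positive definite if one of the matrices $N^1,\ldots,N^6$ is positive definite; furthermore, if $\mathscr{A}$ is an elasticity tensor, then these six conditions are the same.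
   Context: $\mathbb{T}_{6,3}$ is the set of real tensors $\mathscr{A}=(a_{ijklpq})$ with $i,j,k,l,p,q\in\{1,2,3\}$. $\mathscr{A}$ is paired symmetric if $a_{ijklpq}=a_{jiklpq}=a_{ijlkpq}=a_{ijklqp}$ for all indices; a paired symmetric tensor is an elasticity tensor if moreover $a_{ijklpq}=a_{klijpq}=a_{ijpqkl}$ for all indices. For $x,y,z\in\mathbb{R}^3$, $\mathscr{A}x^2y^2z^2:=\sum_{i,j,k,l,p,q=1}^3a_{ijklpq}x_ix_jy_ky_lz_pz_q$; it is positive definite if $\mathscr{A}x^2y^2z^2>0$ for all $x,y,z\in\mathbb{R}^3\setminus\{0\}$, and a sum of squares of trilinear forms if it equals $\sum_{s=1}^r\big(\sum_{i,k,p=1}^3\alpha^s_{ikp}x_iy_kz_p\big)^2$ identically for some $r\ge1$ and real $\alpha^s_{ikp}$. *)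

(* Defs.v *)
From HB Require Import structures.
From mathcomp Require Import all_boot all_order all_algebra.
From mathcomp Require Import reals zify.

Set Implicit Arguments.
Unset Strict Implicit.
Unset Printing Implicit Defensive.
Import Order.TTheory GRing.Theory Num.Theory.
Local Open Scope ring_scope.

Definition tensor63 (R : Type) := 'I_3 -> 'I_3 -> 'I_3 -> 'I_3 -> 'I_3 -> 'I_3 -> R.

Section Tensors.
Variable R : realType.
Implicit Types (a : tensor63 R) (x y z : 'rV[R]_3).

Definition paired_symmetric a : Prop := forall i j k l p q : 'I_3,
  [/\ a i j k l p q = a j i k l p q,
      a i j k l p q = a i j l k p q &
      a i j k l p q = a i j k l q p].

Definition elasticity_tensor a : Prop :=
  paired_symmetric a /\
  forall i j k l p q : 'I_3,
    a i j k l p q = a k l i j p q /\ a i j k l p q = a i j p q k l.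

Definition triquadratic a x y z : R :=
  \sum_(i < 3) \sum_(j < 3) \sum_(k < 3) \sum_(l < 3) \sum_(p < 3) \sum_(q < 3)
    a i j k l p q * x 0 i * x 0 j * y 0 k * y 0 l * z 0 p * z 0 q.

Definition tensor_posdef a : Prop :=
  forall x y z, x != 0 -> y != 0 -> z != 0 -> 0 < triquadratic a x y z.

Definition sos_trilinear a : Prop :=
  exists r : nat, (1 <= r)%N /\
  exists alpha : 'I_r -> 'I_3 -> 'I_3 -> 'I_3 -> R,
  forall x y z,
    triquadratic a x y z =
    \sum_(s < r)
      (\sum_(i < 3) \sum_(k < 3) \sum_(p < 3)
          alpha s i k p * x 0 i * y 0 k * z 0 p) ^+ 2.

Definition mx_psd n (M : 'M[R]_n) : Prop :=
  M^T = M /\ forall v : 'rV[R]_n, 0 <= (v *m M *m v^T) 0 0.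

Definition mx_pd n (M : 'M[R]_n) : Prop :=
  M^T = M /\ forall v : 'rV[R]_n, v != 0 -> 0 < (v *m M *m v^T) 0 0.

End Tensors.

(* Zero-based form of the index 9(i-1) + 3(k-1) + p of {1, ..., 27}. *)
Definition idx27 (i k p : 'I_3) : 'I_27 := inord (9 * i + 3 * k + p).

(* The three ternary digits of an index, most significant first. *)
Definition dig0 (u : 'I_27) : 'I_3 := inord (u %/ 9).
Definition dig1 (u : 'I_27) : 'I_3 := inord ((u %/ 3) %% 3).
Definition dig2 (u : 'I_27) : 'I_3 := inord (u %% 3).

Lemma idx27_val i k p : idx27 i k p = (9 * i + 3 * k + p)%N :> nat.
Proof.
have [hi hk hp] : [/\ i < 3, k < 3 & p < 3]%N by [].
by rewrite inordK //; lia.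
Qed.

Lemma dig0_idx27 i k p : dig0 (idx27 i k p) = i.
Proof.
have [hi hk hp] : [/\ i < 3, k < 3 & p < 3]%N by [].
by apply: val_inj; rewrite /dig0 idx27_val /= inordK; lia.
Qed.

Lemma dig1_idx27 i k p : dig1 (idx27 i k p) = k.
Proof.
have [hi hk hp] : [/\ i < 3, k < 3 & p < 3]%N by [].
by apply: val_inj; rewrite /dig1 idx27_val /= inordK; lia.
Qed.

Lemma dig2_idx27 i k p : dig2 (idx27 i k p) = p.
Proof.
have [hi hk hp] : [/\ i < 3, k < 3 & p < 3]%N by [].
by apply: val_inj; rewrite /dig2 idx27_val /= inordK; lia.
Qed.

Lemma idx27_dig u : idx27 (dig0 u) (dig1 u) (dig2 u) = u.
Proof.
have hu : (u < 27)%N by [].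
by apply: val_inj; rewrite /= idx27_val /dig0 /dig1 /dig2 !inordK; lia.
Qed.

Section Unfoldings.
Variable R : realType.
Variable a : tensor63 R.

Definition N1 : 'M[R]_27 := \matrix_(u, v)
  a (dig0 u) (dig0 v) (dig1 u) (dig1 v) (dig2 u) (dig2 v).
Definition N2 : 'M[R]_27 := \matrix_(u, v)
  a (dig1 u) (dig1 v) (dig0 u) (dig0 v) (dig2 u) (dig2 v).
Definition N3 : 'M[R]_27 := \matrix_(u, v)
  a (dig2 u) (dig2 v) (dig1 u) (dig1 v) (dig0 u) (dig0 v).
Definition N4 : 'M[R]_27 := \matrix_(u, v)
  a (dig0 u) (dig0 v) (dig2 u) (dig2 v) (dig1 u) (dig1 v).
Definition N5 : 'M[R]_27 := \matrix_(u, v)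
  a (dig2 u) (dig2 v) (dig0 u) (dig0 v) (dig1 u) (dig1 v).
Definition N6 : 'M[R]_27 := \matrix_(u, v)
  a (dig1 u) (dig1 v) (dig2 u) (dig2 v) (dig0 u) (dig0 v).

(* Entrywise characterizations; by idx27_dig each determines its matrix. *)
Lemma N1E i j k l p q : N1 (idx27 i k p) (idx27 j l q) = a i j k l p q.
Proof. by rewrite mxE !(dig0_idx27, dig1_idx27, dig2_idx27). Qed.

Lemma N2E i j k l p q : N2 (idx27 k i p) (idx27 l j q) = a i j k l p q.
Proof. by rewrite mxE !(dig0_idx27, dig1_idx27, dig2_idx27). Qed.

Lemma N3E i j k l p q : N3 (idx27 p k i) (idx27 q l j) = a i j k l p q.
Proof. by rewrite mxE !(dig0_idx27, dig1_idx27, dig2_idx27). Qed.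

Lemma N4E i j k l p q : N4 (idx27 i p k) (idx27 j q l) = a i j k l p q.
Proof. by rewrite mxE !(dig0_idx27, dig1_idx27, dig2_idx27). Qed.

Lemma N5E i j k l p q : N5 (idx27 k p i) (idx27 l q j) = a i j k l p q.
Proof. by rewrite mxE !(dig0_idx27, dig1_idx27, dig2_idx27). Qed.

Lemma N6E i j k l p q : N6 (idx27 p i k) (idx27 q j l) = a i j k l p q.
Proof. by rewrite mxE !(dig0_idx27, dig1_idx27, dig2_idx27). Qed.

Definition unfolding (s : 'I_6) : 'M[R]_27 :=
  tnth [tuple N1; N2; N3; N4; N5; N6] s.

End Unfoldings.

(* Main.v *)
Require Import Defs.
From mathcomp Require Import all_boot all_order all_algebra.
From mathcomp Require Import reals.
From mathcomp Require Import all_fingroup ring lra.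

(** The six matrices are conjugate by permutations of the 27 indices, for every
    tensor, so everything reduces to N^1, for which A x^2 y^2 z^2 is the value
    of the quadratic form at the nonzero vector x (x) y (x) z.  A positive
    semidefinite matrix factors as B^T B (Cholesky, by Schur complements), and
    the entries of B (x (x) y (x) z) are the trilinear forms. *)

Set Implicit Arguments.
Unset Strict Implicit.
Unset Printing Implicit Defensive.
Import Order.TTheory GRing.Theory Num.Theory.
Local Open Scope ring_scope.

Lemma dotmxC (R : comPzRingType) (n : nat) (u v : 'rV[R]_n) :
  (u *m v^T) 0 0 = (v *m u^T) 0 0.
Proof. by rewrite !mxE; apply: eq_bigr => i _; rewrite !mxE mulrC. Qed.

(** Ordered as a quadratic polynomial in [t], so that well-chosen values of [t] turn nonnegativity
    of the form into facts about [c], [b] and [D]. *)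
Lemma quad_row_block (R : comPzRingType) (n : nat) (c t : R) (b w : 'rV[R]_n)
    (D : 'M[R]_n) :
  (row_mx t%:M w *m block_mx c%:M b b^T D *m (row_mx t%:M w)^T) 0 0 =
  c * t ^+ 2 + 2 * t * (b *m w^T) 0 0 + (w *m D *m w^T) 0 0.
Proof.
have bw := dotmxC w b.
rewrite mul_row_block tr_row_mx mul_row_col !mulmxDl !tr_scalar_mx.
rewrite -!scalar_mxM !mul_scalar_mx !mul_mx_scalar -!scalemxAl.
move: bw; move: (w *m b^T) (b *m w^T) (w *m D *m w^T) => wb bw wDw e.
by rewrite !mxE /= e; ring.
Qed.

Lemma row_mulmx_tr_eq0 (R : realType) (n : nat) (b : 'rV[R]_n) :
  (b *m b^T) 0 0 = 0 -> b = 0.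
Proof.
rewrite mxE => /eqP; rewrite psumr_eq0 => [|i _]; last by rewrite mxE -expr2 sqr_ge0.
move=> /allP b0; apply/rowP => i; have := b0 i (mem_index_enum i).
by rewrite !mxE /= mulf_eq0 orbb => /eqP.
Qed.

(** Induction on the size: the Schur complement of the corner entry is again positive semidefinite,
    and its factor is bordered by one new row. A singular [M] may have corner entry zero, but then
    its whole first row vanishes. *)
Lemma mx_psd_factor (R : realType) (n : nat) (M : 'M[R]_n) :
  mx_psd M -> exists B : 'M[R]_n, M = B^T *m B.
Proof.
elim: n M => [|n IHn] M; first by exists 0; apply/matrixP => -[].
rewrite -[n.+1]/(1 + n)%N in M *.
move=> [symM posM]; pose c : R := M 0 0; pose b : 'rV_n := ursubmx M.
pose D : 'M_n := drsubmx M.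
have defM : M = block_mx c%:M b b^T D.
  rewrite -[LHS]submxK; congr block_mx.
    by rewrite [ulsubmx _]mx11_scalar !mxE !lshift0.
  by rewrite /b trmx_ursub symM.
have symD : D^T = D by rewrite /D trmx_drsub symM.
clearbody c b D.
have posq t (w : 'rV_n) : 0 <= c * t ^+ 2 + 2 * t * (b *m w^T) 0 0 + (w *m D *m w^T) 0 0.
  by have := posM (row_mx t%:M w); rewrite defM quad_row_block.
have c_ge0 : 0 <= c.
  by have := posq 1 0; rewrite trmx0 mulmx0 mulmx0 mxE; lra.
(* With [c = 0] the form is affine in [t]; at [w = b] its slope is twice the squared norm of [b],
   and a nonzero slope would give negative values. *)
have b0 : c = 0 -> b = 0.
  move=> c0; apply: row_mulmx_tr_eq0; set s := (b *m b^T) 0 0.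
  have [//|s_neq0] := eqVneq s 0.
  (* This t makes the form equal to -1. *)
  have := posq (- ((b *m D *m b^T) 0 0 + 1) / (2 * s)) b; rewrite -/s c0.
  set d := (b *m D *m b^T) 0 0.
  rewrite (_ : _ + _ = - 1); [by lra | by field].
(* For c = 0 the convention 0^-1 = 0 makes this D itself, and b = 0 by b0. *)
have [B' defS] : exists B : 'M[R]_n, D - c^-1 *: (b^T *m b) = B^T *m B.
  apply: IHn; split; first by rewrite linearB linearZ /= trmx_mul trmxK symD.
  (* For [c] nonzero this [t] minimises the quadratic polynomial, and the minimum is the Schur
     complement form at [w]. *)
  move=> w; have := posq (- c^-1 * (b *m w^T) 0 0) w.
  have -> : (w *m (D - c^-1 *: (b^T *m b)) *m w^T) 0 0 =
            (w *m D *m w^T) 0 0 - c^-1 * (b *m w^T) 0 0 ^+ 2.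
    rewrite mulmxBr mulmxBl -scalemxAr -scalemxAl mulmxA -(mulmxA (w *m b^T)).
    rewrite [w *m b^T]mx11_scalar mul_scalar_mx dotmxC.
    by move: (w *m D *m w^T) (b *m w^T) => u v; rewrite !mxE expr2.
  have [c0|c_neq0] := eqVneq c 0; first by rewrite c0 invr0; lra.
  by rewrite (_ : _ + _ = (w *m D *m w^T) 0 0 - c^-1 * (b *m w^T) 0 0 ^+ 2) //; field.
(* Block upper triangular Cholesky factor; for [c = 0] its first row is zero, consistently with
   [b = 0]. *)
exists (block_mx (Num.sqrt c)%:M ((Num.sqrt c)^-1 *: b) 0 B').
have sqc : Num.sqrt c * Num.sqrt c = c by rewrite -expr2 sqr_sqrtr.
have sqb : Num.sqrt c *: ((Num.sqrt c)^-1 *: b) = b.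
  have [c0|c_neq0] := eqVneq c 0; first by rewrite b0 // !scaler0.
  by rewrite scalerA divff ?scale1r // sqrtr_eq0 -ltNge lt0r c_neq0.
rewrite tr_block_mx mulmx_block !trmx0 !mul0mx !mulmx0 !addr0 tr_scalar_mx.
rewrite -scalar_mxM sqc mul_scalar_mx sqb mul_mx_scalar.
have -> : Num.sqrt c *: ((Num.sqrt c)^-1 *: b)^T = b^T.
  by rewrite -[in RHS]sqb [RHS]linearZ.
have -> : ((Num.sqrt c)^-1 *: b)^T *m ((Num.sqrt c)^-1 *: b) = c^-1 *: (b^T *m b).
  by rewrite [X in X *m _]linearZ -scalemxAl -scalemxAr scalerA -invfM sqc.
by rewrite -defS addrC subrK.
Qed.

Lemma mx_psd_congr (R : realType) (n : nat) (P M : 'M[R]_n) :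
  mx_psd M -> mx_psd (P *m M *m P^T).
Proof.
move=> [symM posM]; split; first by rewrite !trmx_mul trmxK symM mulmxA.
by move=> v; have := posM (v *m P); rewrite trmx_mul !mulmxA.
Qed.

Lemma mx_pd_congr (R : realType) (n : nat) (P M : 'M[R]_n) :
  P \in unitmx -> mx_pd M -> mx_pd (P *m M *m P^T).
Proof.
move=> unitP [symM posM]; split; first by rewrite !trmx_mul trmxK symM mulmxA.
move=> v v_neq0; have := posM (v *m P); rewrite trmx_mul !mulmxA; apply.
by apply: contra_neq v_neq0 => vP0; rewrite -(mulmxK unitP v) vP0 mul0mx.
Qed.

(** With the three digit maps in any order, this permutes the ternary digits of an index. *)
Definition shuffle (d0 d1 d2 : 'I_27 -> 'I_3) (u : 'I_27) : 'I_27 :=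
  idx27 (d0 u) (d1 u) (d2 u).

Lemma unfolding_congr (R : realType) (a : tensor63 R) (s : 'I_6) :
  exists P : 'M[R]_27,
    [/\ P \in unitmx, unfolding a s = P *m N1 a *m P^T
      & N1 a = P^T *m unfolding a s *m P^T^T].
Proof.
have [f inj_f defN] : exists2 f, injective f & unfolding a s = mxsub f f (N1 a).
  have inj_dig u v : dig0 u = dig0 v -> dig1 u = dig1 v -> dig2 u = dig2 v -> u = v.
    by move=> e0 e1 e2; rewrite -(idx27_dig u) e0 e1 e2 idx27_dig.
  have injS d0 d1 d2 u v : shuffle d0 d1 d2 u = shuffle d0 d1 d2 v ->
      [/\ d0 u = d0 v, d1 u = d1 v & d2 u = d2 v].
    move=> e; have := (congr1 dig0 e, congr1 dig1 e, congr1 dig2 e).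
    by rewrite !(dig0_idx27, dig1_idx27, dig2_idx27) => -[[]].
  have dig := (dig0_idx27, dig1_idx27, dig2_idx27).
  (* Each shuffle lists the digits in the order in which its matrix passes them to the index pairs
     [i j], [k l], [p q] of [a]. *)
  case: s => -[|[|[|[|[|[|//]]]]]] ?;
    [ exists (shuffle dig0 dig1 dig2) | exists (shuffle dig1 dig0 dig2)
    | exists (shuffle dig2 dig1 dig0) | exists (shuffle dig0 dig2 dig1)
    | exists (shuffle dig2 dig0 dig1) | exists (shuffle dig1 dig2 dig0) ];
    by [move=> u v /injS[]; auto | apply/matrixP => u v; rewrite !mxE !dig].
(* An injective self-map of a finite type is a permutation, so reindexing by [f] is conjugation by a
   matrix whose transpose is its inverse. *)
pose P : 'M[R]_27 := perm_mx (perm inj_f).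
have defP : unfolding a s = P *m N1 a *m P^T.
  rewrite tr_perm_mx -mulmxA -col_permE -row_permE defN.
  by apply/matrixP => u v; rewrite !mxE !permE.
exists P; split=> //; first exact: unitmx_perm.
rewrite defP trmxK !mulmxA tr_perm_mx -perm_mxM mulVg perm_mx1 mul1mx.
by rewrite -mulmxA -perm_mxM mulVg perm_mx1 mulmx1.
Qed.

Lemma unfolding_psd (R : realType) (a : tensor63 R) (s : 'I_6) :
  mx_psd (unfolding a s) <-> mx_psd (N1 a).
Proof.
have [P [_ defN defN1]] := unfolding_congr a s.
by split=> [psdN|psdN1]; [rewrite defN1|rewrite defN]; apply: mx_psd_congr.
Qed.

Lemma unfolding_pd (R : realType) (a : tensor63 R) (s : 'I_6) :
  mx_pd (unfolding a s) <-> mx_pd (N1 a).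
Proof.
have [P [unitP defN defN1]] := unfolding_congr a s.
split=> [pdN|pdN1]; first by rewrite defN1; apply: mx_pd_congr; rewrite ?unitmx_tr.
by rewrite defN; apply: mx_pd_congr.
Qed.

(** The Kronecker product of the three vectors, in the index order of [N1]. *)
Definition tens3 (R : realType) (x y z : 'rV[R]_3) : 'rV[R]_27 :=
  \row_u (x 0 (dig0 u) * y 0 (dig1 u) * z 0 (dig2 u)).

Lemma tens3E (R : realType) (x y z : 'rV[R]_3) i k p :
  tens3 x y z 0 (idx27 i k p) = x 0 i * y 0 k * z 0 p.
Proof. by rewrite mxE dig0_idx27 dig1_idx27 dig2_idx27. Qed.

Lemma tens3_neq0 (R : realType) (x y z : 'rV[R]_3) :
  x != 0 -> y != 0 -> z != 0 -> tens3 x y z != 0.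
Proof.
move=> /rV0Pn[i xi] /rV0Pn[k yk] /rV0Pn[p zp].
by apply/rV0Pn; exists (idx27 i k p); rewrite tens3E !mulf_neq0.
Qed.

Lemma sum_idx27 (R : realType) (F : 'I_27 -> R) :
  \sum_u F u = \sum_(i < 3) \sum_(k < 3) \sum_(p < 3) F (idx27 i k p).
Proof.
rewrite pair_big pair_big /=.
rewrite (reindex (fun w : 'I_3 * 'I_3 * 'I_3 => idx27 w.1.1 w.1.2 w.2)) //=.
exists (fun u => (dig0 u, dig1 u, dig2 u)) => [[[i k] p] _ | u _] /=.
  by rewrite dig0_idx27 dig1_idx27 dig2_idx27.
exact: idx27_dig.
Qed.

Lemma triquadraticE (R : realType) (a : tensor63 R) (x y z : 'rV[R]_3) :
  triquadratic a x y z = (tens3 x y z *m N1 a *m (tens3 x y z)^T) 0 0.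
Proof.
transitivity (\sum_u \sum_v tens3 x y z 0 u * N1 a u v * tens3 x y z 0 v); last first.
  rewrite exchange_big mxE; apply: eq_bigr => v _.
  by rewrite !mxE big_distrl; apply: eq_bigr => u _; rewrite !mxE.
(* The matrix side sums in the order i, k, p, j, l, q and the tensor side in the order i, j, k, l,
   p, q; the exchanges align them one index at a time. *)
rewrite sum_idx27 /triquadratic; apply: eq_bigr => i _.
rewrite exchange_big; apply: eq_bigr => k _.
rewrite [RHS](eq_bigr _ (fun p _ => sum_idx27 _)) [RHS]exchange_big.
apply: eq_bigr => j _; rewrite [RHS]exchange_big; apply: eq_bigr => l _.
apply: eq_bigr => p _; apply: eq_bigr => q _.
by rewrite !tens3E N1E; ring.
Qed.

Lemma psd_sos_trilinear (R : realType) (a : tensor63 R) :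
  mx_psd (N1 a) -> sos_trilinear a.
Proof.
move=> /mx_psd_factor[B defN]; exists 27; split=> //.
(* Row [s] of [B], read as a 3 by 3 by 3 array, holds the coefficients of one form; the sum of
   squares is the squared norm of [B] applied to the Kronecker product. *)
exists (fun s i k p => B s (idx27 i k p)) => x y z.
have -> : triquadratic a x y z = ((B *m (tens3 x y z)^T)^T *m (B *m (tens3 x y z)^T)) 0 0.
  by rewrite triquadraticE defN trmx_mul trmxK !mulmxA.
rewrite mxE; apply: eq_bigr => s _; rewrite [_^T 0 s]mxE -expr2; congr (_ ^+ 2).
rewrite mxE sum_idx27; do 3![apply: eq_bigr => ? _].
by rewrite [_^T _ _]mxE tens3E; ring.
Qed.

Theorem theorem5p12 (R : realType) (a : tensor63 R) (ha : paired_symmetric a) :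
  (((exists s : 'I_6, mx_psd (unfolding a s)) -> sos_trilinear a) /\
   (elasticity_tensor a ->
      forall s t : 'I_6, mx_psd (unfolding a s) <-> mx_psd (unfolding a t))) /\
  (((exists s : 'I_6, mx_pd (unfolding a s)) -> tensor_posdef a) /\
   (elasticity_tensor a ->
      forall s t : 'I_6, mx_pd (unfolding a s) <-> mx_pd (unfolding a t))).
Proof.
split; split.
- by move=> [s /unfolding_psd]; exact: psd_sos_trilinear.
- by move=> _ s t; rewrite !unfolding_psd.
- move=> [s /unfolding_pd[_ posN]] x y z x_neq0 y_neq0 z_neq0.
  by rewrite triquadraticE posN ?tens3_neq0.
- by move=> _ s t; rewrite !unfolding_pd.
Qed.
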